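(* Let $H_1,H_2$ be Hilbert spaces with an isometric (unitary) action of a group $\Gamma$, let $\gamma\in\Gamma$, and let $\gamma_1,\gamma_2$ denote the action of $\gamma$ on $H_1$ and $H_2$ respectively. Let $T:H_1\to H_2$ be a (possibly unbounded) $\gamma$-equivariant Fredholm operator. Then $$\mathrm{ind}_\gamma(T)=\sum_{\lambda\in\mathrm{Eig}(\gamma_1)}\lambda\,\mathrm{ind}\big(T|_{E_\lambda(\gamma_1)\to E_\lambda(\gamma_2)}\big).$$
   Context: $T$ is $\gamma$-equivariant if $\gamma_1$ and $\gamma_1^{-1}$ preserve the domain of $T$ and $T\gamma_1=\gamma_2T$. A (possibly unbounded) Fredholm operator is a closed densely defined operator with closed range and finite-dimensional kernel and cokernel. $\mathrm{Eig}(S)$ is the set of eigenvalues of a normal operator $S$, and $E_\lambda(S)$ is the range of the spectral projection of $S$ for $\{\lambda\}$, i.e. the $\lambda$-eigenspace of $S$ (possibly $0$). $T|_{E_\lambda(\gamma_1)\to E_\lambda(\gamma_2)}$ is the restriction of $T$ to $E_\lambda(\gamma_1)$ (with domain $\mathrm{dom}(T)\cap E_\lambda(\gamma_1)$) with codomain restricted to $E_\lambda(\gamma_2)$. The equivariant index is $\mathrm{ind}_\gamma(T):=\mathrm{tr}(\gamma_1|_{\ker T})-\mathrm{tr}(\gamma_2|_{\ker T^*})$, and $\mathrm{ind}$ is the usual Fredholm index.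
   Formalization: The sum over Eig(γ₁) alone is false (T: ℂ→ℂ² the first-coordinate inclusion, γ₁=1, γ₂=diag(1,−1)); it is proved over Eig(γ₁)∪Eig(γ₂), and over Eig(γ₁) when Eig(γ₂)⊆Eig(γ₁). *)

(* Defs.v *)
From HB Require Import structures.
From mathcomp Require Import all_boot all_order all_algebra.
From mathcomp Require Import sesquilinear complex.
From mathcomp Require Import all_classical all_reals all_analysis.
Import Order.TTheory GRing.Theory Num.Theory.
Import numFieldNormedType.Exports.

Set Implicit Arguments.
Unset Strict Implicit.
Unset Printing Implicit Defensive.

Local Open Scope classical_set_scope.
Local Open Scope ring_scope.
Local Open Scope complex_scope.

(* Complex Hilbert spaces.  The inner product is linear in its first argument
   and conjugate-linear in the second one. *)
HB.mixin Record CompleteNormedModule_isHilbert (R : realType) H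
    of CompleteNormedModule R[i] H := {
  inner : {dot H for (@Num.conj R[i])} ;
  sqr_norm_inner : forall x : H, `|x| ^+ 2 = inner x x }.

#[short(type="hilbertType")]
HB.structure Definition Hilbert (R : realType) :=
  {H of CompleteNormedModule_isHilbert R H & CompleteNormedModule R[i] H}.

(* The maps rho g are invertible, with inverse rho g^-1, so that linear
   isometric means unitary here. *)
Record unitary_rep (R : realType) (Gamma : groupType) (H : hilbertType R) :=
  UnitaryRep {
    rep :> Gamma -> {linear H -> H} ;
    rep1 : forall x, rep 1%g x = x ;
    repM : forall g h x, rep (g * h)%g x = rep g (rep h x) ;
    rep_isometric : forall g x, `|rep g x| = `|x| }.

Section LinearAlgebra.
Context {K : fieldType} {V : lmodType K}.
Implicit Types (A U W : set V) (f : V -> V).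

Definition linear_subspace A :=
  A 0 /\ forall (a : K) x y, A x -> A y -> A (a *: x + y).

(* The classes of the s i form a basis of W / U. *)
Definition quotient_basis W U n (s : 'I_n -> V) :=
  [/\ forall i, W (s i),
      forall a : 'I_n -> K, U (\sum_i a i *: s i) -> forall i, a i = 0 &
      forall w, W w -> exists a : 'I_n -> K, U (w - \sum_i a i *: s i)].

Definition finite_codim W U := exists n (s : 'I_n -> V), quotient_basis W U s.

(* dim (W / U) if it is finite, and 0 otherwise *)
Definition codim W U : nat :=
  xget 0%N [set n | exists s : 'I_n -> V, quotient_basis W U s].

Definition finite_dim A := finite_codim A [set 0].
Definition dim A := codim A [set 0].

Definition is_trace A f (t : K) :=
  exists n (s : 'I_n -> V) (M : 'M[K]_n),
    [/\ quotient_basis A [set 0] s,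
        forall j, f (s j) = \sum_i M i j *: s i & t = \tr M].

(* tr (f|A) if A is finite-dimensional and f-invariant, and 0 otherwise *)
Definition trace A f : K := xget 0 (is_trace A f).

Definition eigenspace_of f (lambda : K) : set V := [set x | f x = lambda *: x].

Definition Eig f : set K :=
  [set lambda | exists2 x, x != 0 & eigenspace_of f lambda x].

End LinearAlgebra.

(* Partially defined maps; the values of op_fun outside op_dom are junk. *)
Record operator (H1 H2 : Type) := Operator {
  op_dom : set H1 ;
  op_fun :> H1 -> H2 }.

Section Operators.
Context {R : realType} {H1 H2 : hilbertType R}.
Implicit Types (T : operator H1 H2) (V : set H1) (W : set H2).

Definition op_ker T : set H1 := [set x | op_dom T x /\ T x = 0].
Definition op_range T : set H2 := T @` op_dom T.
Definition op_graph T : set (H1 * H2) :=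
  [set p | op_dom T p.1 /\ p.2 = T p.1].

(* T is an unbounded operator from the subspace V to the subspace W. *)
Definition linear_operator V W T :=
  [/\ linear_subspace (op_dom T), op_dom T `<=` V, op_range T `<=` W &
      forall (a : R[i]) x y, op_dom T x -> op_dom T y ->
        T (a *: x + y) = a *: T x + T y].

(* T as an operator V -> W between closed subspaces, regarded as Hilbert spaces
   of their own.  As V and W are closed, the graph and the range of T are closed
   relatively to V * W and W iff they are so in H1 * H2 and H2. *)
Definition fredholm V W T :=
  [/\ [/\ linear_subspace V, closed V, linear_subspace W & closed W],
      linear_operator V W T,
      closed (op_graph T) /\ V `<=` closure (op_dom T),
      closed (op_range T) &
      finite_dim (op_ker T) /\ finite_codim W (op_range T)].

Definition fredholm_index W T : int :=
  (dim (op_ker T))%:Z - (codim W (op_range T))%:Z.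

Definition restrict T V : operator H1 H2 :=
  Operator (op_dom T `&` V) T.

Definition adjoint_at T (y : H2) (z : H1) :=
  forall x, op_dom T x -> inner (T x) y = inner x z.

(* adjoint_at T y z determines z when T is densely defined. *)
Definition adjoint T : operator H2 H1 :=
  Operator [set y | exists z, adjoint_at T y z]
           (fun y => xget 0 (adjoint_at T y)).

End Operators.

Section Equivariance.
Context {R : realType} {Gamma : groupType} {H1 H2 : hilbertType R}.
Variables (rho1 : unitary_rep Gamma H1) (rho2 : unitary_rep Gamma H2).
Variables (g : Gamma) (T : operator H1 H2).

Definition equivariant :=
  [/\ forall x, op_dom T x -> op_dom T (rho1 g x),
      forall x, op_dom T x -> op_dom T (rho1 (g^-1)%g x) &
      forall x, op_dom T x -> T (rho1 g x) = rho2 g (T x)].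

Definition equivariant_index : R[i] :=
  trace (op_ker T) (rho1 g) - trace (op_ker (adjoint T)) (rho2 g).

(* T as an operator E_lambda(rho1 g) -> E_lambda(rho2 g) *)
Definition eigen_fredholm (lambda : R[i]) :=
  fredholm (eigenspace_of (rho1 g) lambda) (eigenspace_of (rho2 g) lambda)
    (restrict T (eigenspace_of (rho1 g) lambda)).

Definition eigen_index (lambda : R[i]) : int :=
  fredholm_index (eigenspace_of (rho2 g) lambda)
    (restrict T (eigenspace_of (rho1 g) lambda)).

End Equivariance.

(* Main.v *)
Require Import Defs.
From HB Require Import structures.
From mathcomp Require Import all_boot all_order all_algebra.
From mathcomp Require Import ring.
From mathcomp Require Import sesquilinear complex.
From mathcomp Require Import all_classical all_reals all_analysis.
Import Order.TTheory GRing.Theory Num.Theory.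
Import numFieldNormedType.Exports.

Set Implicit Arguments.
Unset Strict Implicit.
Unset Printing Implicit Defensive.

Local Open Scope classical_set_scope.
Local Open Scope ring_scope.
Local Open Scope complex_scope.

(** Write [U1], [U2] for the unitaries by which [g] acts on [H1] and [H2], and
    [E1], [E2] for their [lambda]-eigenspaces.

    Both sides of the formula only see two finite-dimensional spaces, on which
    [g] acts by isometries: the kernel of [T] and the orthogonal complement of
    its range, which is the kernel of the adjoint ([ker_adjoint]).  An isometry
    of a finite-dimensional space is diagonalizable ([isometry_eigenbasis]), so
    its trace is the sum over [lambda] of [lambda] times the dimension of the
    [lambda]-eigenspace ([spectrum_exists]).  The theorem follows once the
    kernel and the cokernel of the restriction of [T] to [E1 -> E2] are
    identified with the [lambda]-eigenspaces of those two spaces.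

    For the kernel this is immediate.  For the cokernel it says that the range of
    the restriction is the whole of [range T `&` E2] ([range_restrict]), and
    that [E2] is the sum of [range T `&` E2] and of its intersection with the
    orthogonal complement of the range ([coker_eigen_decomposition]).  The
    latter holds because [H2] is the sum of the range and its orthogonal
    complement, both invariant under [U2].  The former is where analysis enters: if [y = T x] lies in [E2], then [y = T (P x)] for the
    orthogonal projection [P] onto [E1], but for an unbounded [T] one needs
    that [P] preserves the domain and intertwines through [T] with the
    projection onto [E2] ([eigen_projection]).  By the mean ergodic theorem
    ([mean_ergodic]), [P x] is the limit of the averages of the vectors
    [lambda^-k *: U1^k x]; these stay in the domain, [T] maps them to the
    averages of [lambda^-k *: U2^k (T x)], and the graph of [T] is closed.  The
    same projection carries the density of the domain over to [E1], so that the
    restrictions are Fredholm ([eigen_restriction_fredholm]).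

    The mean ergodic theorem rests on the projection theorem for closed
    subspaces ([orthogonal_projection]). *)

(** * Bases of quotients, dimension and trace *)

Section Subspaces.
Context {K : fieldType} {V : lmodType K}.
Implicit Types (A B U W : set V).

Lemma subspace0 A : linear_subspace A -> A 0.
Proof. by case. Qed.

Lemma subspaceD A x y : linear_subspace A -> A x -> A y -> A (x + y).
Proof. by move=> [_ lA] Ax Ay; rewrite -[x]scale1r; apply: lA. Qed.

Lemma subspaceZ A (a : K) x : linear_subspace A -> A x -> A (a *: x).
Proof. by move=> [A0 lA] Ax; rewrite -[_ *: _]addr0; apply: lA. Qed.

Lemma subspaceB A x y : linear_subspace A -> A x -> A y -> A (x - y).
Proof.
by move=> lA Ax Ay; rewrite -scaleN1r; apply: subspaceD => //; apply: subspaceZ.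
Qed.

Lemma subspace_sum A (I : Type) (r : seq I) (P : pred I) (F : I -> V) :
  linear_subspace A -> (forall i, P i -> A (F i)) -> A (\sum_(i <- r | P i) F i).
Proof.
move=> lA AF; elim/big_ind: _ => //; first exact: subspace0.
by move=> x y; apply: subspaceD.
Qed.

Lemma subspace_eigenspace (f : {linear V -> V}) (lambda : K) :
  linear_subspace (eigenspace_of f lambda).
Proof.
split=> [|a x y /= fx fy]; first by rewrite /eigenspace_of /= linear0 scaler0.
by rewrite /eigenspace_of /= linearP fx fy scalerDr !scalerA mulrC.
Qed.

Lemma fixed_eigenspace (f : V -> V) (lambda : K) x : lambda != 0 ->
  lambda^-1 *: f x = x <-> eigenspace_of f lambda x.
Proof.
move=> l0; rewrite /eigenspace_of /=; split=> [xE|->].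
  by rewrite -[in RHS]xE scalerA divff // scale1r.
by rewrite scalerA mulVf // scale1r.
Qed.

Lemma subspaceI A B :
  linear_subspace A -> linear_subspace B -> linear_subspace (A `&` B).
Proof.
move=> lA lB; split; first by split; apply: subspace0.
by move=> a x y [Ax Bx] [Ay By]; split; [case: lA|case: lB] => _; apply.
Qed.

Lemma subspace_set0 : linear_subspace ([set 0] : set V).
Proof. by split=> // a x y /= -> ->; rewrite scaler0 addr0. Qed.

(** If [W = U + X] with [U] and [X] independent, then [X] is a model of the
    quotient [W / U]. *)
Lemma quotient_basis_complement W U X n (s : 'I_n -> V) :
  linear_subspace U -> linear_subspace X -> X `<=` W -> U `&` X `<=` [set 0] ->
  (forall w, W w -> exists2 x, X x & U (w - x)) ->
  quotient_basis X [set 0] s -> quotient_basis W U s.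
Proof.
move=> lU lX XW UX dec [Xs free gen]; split=> [i|a Ua|w /dec[x Xx Uwx]].
- exact/XW/Xs.
- by apply: free; apply: UX; split=> //; apply: subspace_sum => // i _;
    apply: subspaceZ.
- have [a /eqP] := gen _ Xx; rewrite subr_eq0 => /eqP xE.
  by exists a; rewrite -xE.
Qed.

(** Conversely, a basis of [W / U] yields a basis of any complement [X], by
    changing the representatives [s i] modulo [U]. *)
Lemma complement_quotient_basis W U X n (s : 'I_n -> V) :
  linear_subspace U -> linear_subspace X -> X `<=` W -> U `&` X `<=` [set 0] ->
  (forall w, W w -> exists2 x, X x & U (w - x)) ->
  quotient_basis W U s -> exists t : 'I_n -> V, quotient_basis X [set 0] t.
Proof.
move=> lU lX XW UX dec [Ws free gen].
have /choice[t tP] : forall i, exists x, X x /\ U (s i - x).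
  by move=> i; have [x] := dec _ (Ws i); exists x.
have Ut a : U (\sum_i a i *: s i - \sum_i a i *: t i).
  rewrite -sumrB; apply: subspace_sum => // i _; rewrite -scalerBr.
  by apply: subspaceZ => //; case: (tP i).
exists t; split=> [i|a at0|x Xx].
- by case: (tP i).
- by apply: free; have := Ut a; rewrite at0 subr0.
- have [a Ua] := gen _ (XW _ Xx).
  exists a; apply: UX; split.
    by have := subspaceD lU Ua (Ut a); rewrite addrA subrK.
  apply: subspaceB => //; apply: subspace_sum => // i _; apply: subspaceZ => //.
  by case: (tP i).
Qed.

(** The sizes [n] and [m] are not assumed equal, so that [quotient_basis_size]
    can be read off from the two matrix products. *)
Lemma change_of_basis W U n m (s : 'I_n -> V) (t : 'I_m -> V) :
  linear_subspace U -> quotient_basis W U s -> quotient_basis W U t ->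
  exists P : 'M[K]_(n, m), exists Q : 'M[K]_(m, n),
    [/\ P *m Q = 1%:M, Q *m P = 1%:M &
        forall j, U (t j - \sum_i P i j *: s i)].
Proof.
move=> lU bs bt.
have coords p q (u : 'I_p -> V) (v : 'I_q -> V) :
    quotient_basis W U u -> quotient_basis W U v ->
    exists A : 'M[K]_(p, q), forall j, U (v j - \sum_i A i j *: u i).
  move=> [_ _ gu] [Wv _ _].
  have /choice[A AP] : forall j, exists a : 'I_p -> K,
      U (v j - \sum_i a i *: u i) by move=> j; exact: gu.
  by exists (\matrix_(i, j) A j i) => j; under eq_bigr do rewrite mxE.
have inv p q (u : 'I_p -> V) (v : 'I_q -> V) (A : 'M[K]_(p, q))
    (B : 'M[K]_(q, p)) : quotient_basis W U u ->
    (forall j, U (v j - \sum_i A i j *: u i)) ->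
    (forall j, U (u j - \sum_i B i j *: v i)) -> A *m B = 1%:M.
  move=> [_ fu _] AP BP; apply/matrixP => i j; apply/eqP.
  rewrite -subr_eq0; apply/eqP; rewrite -opprB; apply/eqP; rewrite oppr_eq0.
  apply/eqP; move: i; apply: fu.
  under eq_bigr do rewrite !mxE scalerBl.
  rewrite sumrB (bigD1 j) //= eqxx scale1r big1 ?addr0; last first.
    by move=> i /negPf ->; rewrite scale0r.
  have -> : \sum_i (\sum_k A i k * B k j) *: u i =
            \sum_k B k j *: \sum_i A i k *: u i.
    under eq_bigr do rewrite scaler_suml.
    rewrite exchange_big /=; apply: eq_bigr => k _; rewrite scaler_sumr.
    by apply: eq_bigr => i _; rewrite scalerA mulrC.
  rewrite -[u j](subrK (\sum_k B k j *: v k)) -addrA; apply: subspaceD => //.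
  rewrite -sumrB; apply: subspace_sum => // k _.
  by rewrite -scalerBr; apply: subspaceZ.
have [P PP] := coords _ _ _ _ bs bt; have [Q QP] := coords _ _ _ _ bt bs.
by exists P, Q; split=> //; [apply: inv bs PP QP|apply: inv bt QP PP].
Qed.

Lemma quotient_basis_size W U n m (s : 'I_n -> V) (t : 'I_m -> V) :
  linear_subspace U -> quotient_basis W U s -> quotient_basis W U t -> n = m.
Proof.
move=> lU bs bt; have [P [Q [PQ QP _]]] := change_of_basis lU bs bt.
by apply/eqP; rewrite eqn_leq (mulmx1_min PQ) (mulmx1_min QP).
Qed.

Lemma codimE W U n (s : 'I_n -> V) :
  linear_subspace U -> quotient_basis W U s -> codim W U = n.
Proof.
move=> lU bs; apply: xget_unique; first by exists s.
by move=> m [t bt]; rewrite (quotient_basis_size lU bs bt).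
Qed.

Lemma dimE A n (s : 'I_n -> V) : quotient_basis A [set 0] s -> Defs.dim A = n.
Proof. exact/codimE/subspace_set0. Qed.

(** The trace does not depend on the basis: matrices [M] and [N] of [f] in two
    bases satisfy [M *m P = P *m N], for the change of basis [P]. *)
Lemma traceE A (f : {linear V -> V}) n (s : 'I_n -> V) (M : 'M[K]_n) :
  quotient_basis A [set 0] s -> (forall j, f (s j) = \sum_i M i j *: s i) ->
  trace A f = \tr M.
Proof.
move=> bs fs; apply: xget_unique; first by exists n, s, M.
move=> _ [m [t [N [bt ft ->]]]].
have [P [Q [PQ QP tP]]] := change_of_basis subspace_set0 bs bt.
have {}tP j : t j = \sum_i P i j *: s i by apply/eqP; rewrite -subr_eq0 tP.
have comb (v : 'I_n -> V) (w : 'I_m -> K) (B : 'M[K]_(n, m)) :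
    \sum_k w k *: (\sum_i B i k *: v i) = \sum_i (\sum_k B i k * w k) *: v i.
  under eq_bigr do rewrite scaler_sumr.
  rewrite exchange_big /=; apply: eq_bigr => i _; rewrite scaler_suml.
  by apply: eq_bigr => k _; rewrite scalerA mulrC.
have MP : M *m P = P *m N.
  apply/matrixP => i j; apply/eqP; rewrite -subr_eq0; apply/eqP.
  case: bs => _ free _; move: i.
  apply: (free (fun i => (M *m P) i j - (P *m N) i j)).
  under eq_bigr do rewrite scalerBl.
  rewrite sumrB; apply/eqP; rewrite subr_eq0; apply/eqP.
  transitivity (f (t j)).
    rewrite tP linear_sum /=.
    under [RHS]eq_bigr do rewrite linearZ /= fs scaler_sumr.
    rewrite exchange_big /=; apply: eq_bigr => i _; rewrite mxE scaler_suml.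
    by apply: eq_bigr => k _; rewrite scalerA mulrC.
  rewrite ft; under eq_bigr do rewrite tP; rewrite comb.
  by apply: eq_bigr => i _; rewrite mxE.
by rewrite -[N]mul1mx -QP -mulmxA -MP mulmxA mxtrace_mulC mulmxA PQ mul1mx.
Qed.

Definition eigenbasis A (f : V -> V) n (t : 'I_n -> V) (mu : 'I_n -> K) :=
  quotient_basis A [set 0] t /\ forall j, f (t j) = mu j *: t j.

Lemma eigenbasis_trace A (f : {linear V -> V}) n (t : 'I_n -> V) mu :
  eigenbasis A f t mu -> trace A f = \sum_j mu j.
Proof.
move=> [bt ft]; rewrite (@traceE _ _ _ _ (diag_mx (\row_j mu j)) bt).
  by rewrite mxtrace_diag; apply: eq_bigr => j _; rewrite mxE.
move=> j; rewrite (bigD1 j) //= !mxE eqxx mulr1n -ft big1 ?addr0 //.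
by move=> i /negPf ij; rewrite !mxE ij mulr0n scale0r.
Qed.

(** The eigenspace is spanned by part of an eigenbasis, since applying
    [f - lambda] multiplies the coordinates by [mu j - lambda]. *)
Lemma eigenbasis_eigenspace A (f : {linear V -> V}) n (t : 'I_n -> V) mu
    (lambda : K) : linear_subspace A -> eigenbasis A f t mu ->
  quotient_basis (A `&` eigenspace_of f lambda) [set 0]
    (fun i : 'I_#|[pred j | mu j == lambda]| => t (enum_val i)).
Proof.
move=> lA [[At free gen] ft]; split.
- by move=> i; split=> //; rewrite /eigenspace_of /= ft; have /eqP -> := enum_valP i.
- move=> a a0 i.
  (* A relation between the selected vectors is extended by zero coefficients to
     a relation [b] between all of them. *)
  pose b j := \sum_(k | enum_val k == j) a k.
  suff b0 : forall j, b j = 0.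
    rewrite -(b0 (enum_val i)) /b (bigD1 i) //= big1 ?addr0 // => k /andP[/eqP e].
    by rewrite (enum_val_inj e) eqxx.
  apply: free; rewrite /= -[RHS]a0; under eq_bigr do rewrite /b scaler_suml.
  rewrite (exchange_big_dep xpredT) //=; apply: eq_bigr => k _.
  by rewrite (big_pred1 (enum_val k)) // => j; rewrite /= eq_sym.
- move=> w [Aw fw]; have [b /eqP] := gen _ Aw; rewrite subr_eq0 => /eqP wE.
  exists (fun i => b (enum_val i)); apply/eqP; rewrite subr_eq0; apply/eqP.
  have b0 j : b j * (mu j - lambda) = 0.
    move: j; apply: free.
    under eq_bigr do rewrite mulrBr scalerBl -scalerA -ft -linearZ.
    rewrite sumrB -linear_sum -wE fw wE scaler_sumr -sumrB big1 // => i _.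
    by rewrite scalerA mulrC subrr.
  rewrite -(big_enum_val (fun j => b j *: t j)) {1}wE /=.
  rewrite (bigID [pred j | mu j == lambda]) /= [X in _ + X]big1 ?addr0 //.
  move=> j nj; have /eqP := b0 j; rewrite mulf_eq0 subr_eq0 (negPf nj) orbF.
  by move=> /eqP ->; rewrite scale0r.
Qed.

Definition line (v : V) : set V := [set a *: v | a in [set: K]].

Lemma subspace_line v : linear_subspace (line v).
Proof.
split=> [|a _ _ [b _ <-] [c _ <-]]; first by exists 0; rewrite ?scale0r.
by exists (a * b + c); rewrite // scalerDl scalerA.
Qed.

(** The exchange lemma: [v] can replace in the basis [s] of [A] any [s k] along
    which it has a nonzero coordinate. *)
Lemma quotient_basis_line A n (s : 'I_n.+1 -> V) v :
  quotient_basis A [set 0] s -> A v -> v != 0 ->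
  exists t : 'I_n -> V, quotient_basis A (line v) t.
Proof.
move=> [As free gen] Av v0.
have [c /eqP] := gen _ Av; rewrite subr_eq0 => /eqP vE.
have [k ck] : exists k, c k != 0.
  apply/existsP; apply: contra_neqT v0 => /existsPn c0.
  by rewrite vE big1 // => i _; move/negbNE/eqP: (c0 i) => ->; rewrite scale0r.
exists (fun j => s (lift k j)); split=> // [a [b _ bv]|w Aw].
  (* [d] lists the coordinates of the relation in the basis [s]; at [k] it is
     [- b * c k], which forces [b = 0]. *)
  pose d i := (if unlift k i is Some j then a j else 0) - b * c i.
  have d0 : forall i, d i = 0.
    apply: free; rewrite /= /d; under eq_bigr do rewrite scalerBl -scalerA.
    rewrite sumrB -scaler_sumr -vE (bigD1_ord k) //= unlift_none scale0r add0r.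
    by under eq_bigr do rewrite liftK; rewrite bv subrr.
  have b0 : b = 0.
    have /eqP := d0 k; rewrite /d unlift_none sub0r oppr_eq0 mulf_eq0.
    by rewrite (negPf ck) orbF => /eqP.
  by move=> j; have := d0 (lift k j); rewrite /d liftK b0 mul0r subr0.
have [b /eqP] := gen _ Aw; rewrite subr_eq0 => /eqP wE.
exists (fun j => b (lift k j) - b k / c k * c (lift k j)).
exists (b k / c k) => //; under [in RHS]eq_bigr do rewrite scalerBl -scalerA.
rewrite sumrB -scaler_sumr {1}vE wE !(bigD1_ord k) //= scalerDr scalerA divfK //.
by rewrite opprB -addrA; congr (_ + _); rewrite addrC subrK.
Qed.

Lemma quotient_basis_cons A X n (t : 'I_n -> V) v :
  linear_subspace A -> linear_subspace X -> A v -> v != 0 -> X `<=` A ->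
  line v `&` X `<=` [set 0] ->
  (forall w, A w -> exists2 x, X x & line v (w - x)) ->
  quotient_basis X [set 0] t ->
  quotient_basis A [set 0] (fun i => oapp t v (unlift ord0 i)).
Proof.
move=> lA lX Av v0 XA vX dec [Xt free gen]; split.
- by move=> i; case: unlift => //= j; apply: XA.
- move=> a; rewrite /= big_ord_recl unlift_none /=.
  under eq_bigr do rewrite liftK /=; move=> /eqP; rewrite addr_eq0 => /eqP avE.
  have a0v : a ord0 *: v = 0.
    apply: vX; split; first by exists (a ord0).
    rewrite avE -sub0r; apply: subspaceB (subspace0 lX) _ => //.
    by apply: subspace_sum => // j _; apply: subspaceZ.
  have a0 : a ord0 = 0.
    by apply/eqP; move/eqP: a0v; rewrite scaler_eq0 (negPf v0) orbF.
  move=> i; case: (unliftP ord0 i) => [j ->|-> //].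
  apply: (free (fun j => a (lift ord0 j))).
  by rewrite /= -[LHS]opprK -avE a0v oppr0.
- move=> w /dec[x Xx [b _ bv]]; have [a /eqP] := gen _ Xx.
  rewrite subr_eq0 => /eqP xE.
  exists (fun i => oapp a b (unlift ord0 i)).
  rewrite /= big_ord_recl unlift_none /=.
  by under eq_bigr do rewrite liftK /=; rewrite -xE bv subrK subrr.
Qed.

End Subspaces.

(** The coordinates of an eigenvector form a row eigenvector of the transposed
    matrix of [f], which has one over an algebraically closed field. *)
Lemma eigenvector_exists (K : closedFieldType) (V : lmodType K) (A : set V)
    (f : {linear V -> V}) n (s : 'I_n.+1 -> V) :
  linear_subspace A -> (forall x, A x -> A (f x)) ->
  quotient_basis A [set 0] s ->
  exists v lambda, [/\ A v, v != 0 & f v = lambda *: v].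
Proof.
move=> lA Af [As free gen].
have /choice[b bP] : forall j, exists b : 'I_n.+1 -> K,
    f (s j) = \sum_i b i *: s i.
  move=> j; have [b /eqP] := gen _ (Af _ (As j)).
  by rewrite subr_eq0 => /eqP; exists b.
pose N := \matrix_(j, i) b j i.
have /closed_rootP[lambda] : size (char_poly N) != 1 by rewrite size_char_poly.
rewrite -eigenvalue_root_char => /eigenvalueP[c cN c0].
exists (\sum_j c 0 j *: s j), lambda; split.
- by apply: subspace_sum => // j _; apply: subspaceZ.
- apply: contra_neq c0 => /free c0; apply/rowP => j.
  by rewrite mxE c0.
- rewrite linear_sum /=.
  under eq_bigr do rewrite linearZ /= bP scaler_sumr.
  rewrite exchange_big scaler_sumr /=; apply: eq_bigr => i _.
  have /rowP/(_ i) := cN; rewrite !mxE scalerA => <-; rewrite scaler_suml.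
  by apply: eq_bigr => j _; rewrite scalerA mxE.
Qed.


(** * The projection theorem *)

Section InnerProduct.
Context {R : realType} {H : hilbertType R}.
Implicit Types (x y z : H).

Lemma innerC x y : inner y x = (inner x y)^*%R.
Proof. by rewrite (hermC _ y x) expr0 mul1r. Qed.

Lemma innerZl (a : R[i]) x y : inner (a *: x) y = a * inner x y.
Proof. by rewrite linearZl_LR. Qed.

Lemma innerZr (a : R[i]) x y : inner x (a *: y) = a^*%R * inner x y.
Proof. by rewrite linearZr_LR. Qed.

Lemma inner_eq0C x y : inner x y = 0 -> inner y x = 0.
Proof. by move=> xy; rewrite innerC xy conjC0. Qed.

Lemma inner_eq0 x : inner x x = 0 -> x = 0.
Proof. by rewrite -sqr_norm_inner => /eqP; rewrite expf_eq0 normr_eq0 => /eqP. Qed.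

Lemma sqr_normD x y :
  `|x + y| ^+ 2 = `|x| ^+ 2 + `|y| ^+ 2 + (inner x y + inner y x).
Proof.
by rewrite !sqr_norm_inner !linearDl !linearDr /=; ring.
Qed.

Lemma parallelogram x y :
  `|x + y| ^+ 2 + `|x - y| ^+ 2 = 2 * `|x| ^+ 2 + 2 * `|y| ^+ 2.
Proof.
by rewrite !sqr_normD linearNr linearNl normrN; ring.
Qed.

Lemma pythagoras x y : inner x y = 0 -> `|x + y| ^+ 2 = `|x| ^+ 2 + `|y| ^+ 2.
Proof. by move=> xy; rewrite sqr_normD xy (inner_eq0C xy) !addr0. Qed.

End InnerProduct.

Section Projection.
Context {R : realType} {H : hilbertType R}.
Implicit Types (x y z : H) (A : set H) (e : R[i]).

Lemma ge0_real_complex e : 0 <= e -> e = (complex.Re e)%:C.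
Proof. by move=> e0; rewrite RRe_real // ger0_real. Qed.

(** Norms take values in [R[i]], where the order is partial; the archimedean
    property is transported from [R] through the real part. *)
Lemma natSinv_small e : 0 < e -> \forall n \near \oo, n.+1%:R^-1 < e.
Proof.
move=> e0; have eE := ge0_real_complex (ltW e0).
have e'0 : 0 < complex.Re e by rewrite -ltcR -eE.
near=> n; rewrite eE -(rmorph_nat (real_complex R)) -fmorphV /= ltcR.
by near: n; apply: (near_infty_natSinv_lt (PosNum e'0)).
Unshelve. all: by end_near. Qed.

Lemma closure_approx A x e :
  closure A x -> 0 < e -> exists2 y, A y & `|x - y| < e.
Proof.
move=> cAx e0; have [y [Ay]] := cAx _ (nbhsx_ballx x e e0).
by rewrite -ball_normE; exists y.
Qed.

(** The distance [d] from [x] to [A] has to be found among the real parts,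
    since infima exist only in [R]. *)
Lemma distance_exists A x : A 0 -> exists d : R[i],
  [/\ 0 <= d, forall y, A y -> d <= `|x - y| &
      forall e, 0 < e -> exists2 y, A y & `|x - y| < d + e].
Proof.
move=> A0; pose N y : R := complex.Re `|x - y|.
have NE y : `|x - y| = (N y)%:C by apply: ge0_real_complex.
have N0 y : 0 <= N y by rewrite -lecR -NE; apply: normr_ge0.
have lbN : lbound (N @` A) 0 by move=> _ [y _ <-].
have infN : has_inf (N @` A) by split; [exists (N 0), 0|exists 0].
exists (inf (N @` A))%:C; split.
- by rewrite lecR; apply: lb_le_inf => //; case: infN.
- move=> y Ay; rewrite NE lecR; apply: ge_inf; last by exists y.
  by exists 0.
- move=> e e0; have eE := ge0_real_complex (ltW e0).
  have e'0 : 0 < complex.Re e by rewrite -ltcR -eE.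
  have [_ [y Ay <-] yd] := inf_adherent e'0 infN.
  by exists y => //; rewrite NE eE -rmorphD /= ltcR.
Qed.

(** A minimizing sequence of the distance is a Cauchy sequence, by the
    parallelogram identity. *)
Lemma nearest_point A x : linear_subspace A -> closed A ->
  exists2 p, A p & forall y, A y -> `|x - p| <= `|x - y|.
Proof.
move=> lA cA; have [d [d0 dmin dapx]] := distance_exists x (subspace0 lA).
have /choice[w wP] : forall n : nat,
    exists y, A y /\ `|x - y| < d + n.+1%:R^-1.
  by move=> n; have [|y Ay] := dapx n.+1%:R^-1; [rewrite invr_gt0 ltr0n|exists y].
have small n m : (n <= m)%N ->
    `|w n - w m| ^+ 2 <= (8 * d + 4) * n.+1%:R^-1.
  move=> nm; set t := n.+1%:R^-1.
  have t0 : 0 <= t by rewrite invr_ge0 ler0n.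
  have t1 : t <= 1 by rewrite invf_le1 ?ltr0n // ler1n.
  have wn : `|x - w n| ^+ 2 <= (d + t) ^+ 2.
    by rewrite ler_pXn2r ?nnegrE ?addr_ge0 //; apply/ltW; case: (wP n).
  have wm : `|x - w m| ^+ 2 <= (d + t) ^+ 2.
    rewrite ler_pXn2r ?nnegrE ?addr_ge0 //.
    have [_ /ltW/le_trans->//] := wP m.
    by rewrite lerD2l lef_pV2 ?posrE ?ltr0n // ler_nat.
  (* The midpoint of [w n] and [w m] is in [A], so not closer to [x] than [d]. *)
  have mid : (2 * d) ^+ 2 <= `|(x - w n) + (x - w m)| ^+ 2.
    rewrite ler_pXn2r ?nnegrE ?mulr_ge0 //.
    have -> : (x - w n) + (x - w m) = 2 *: (x - 2^-1 *: (w n + w m)).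
      rewrite scalerBr scalerA divff ?pnatr_eq0 // scale1r scaler_nat mulr2n.
      by rewrite opprD addrACA.
    rewrite normrZ ger0_norm // ler_pM2l //; apply: dmin.
    by apply: subspaceZ => //; apply: subspaceD => //; [case: (wP n)|case: (wP m)].
  have par := parallelogram (x - w n) (x - w m).
  have wE : (x - w n) - (x - w m) = w m - w n.
    by rewrite opprB addrC addrA subrK.
  rewrite wE [`|w m - _|]distrC in par.
  have -> : `|w n - w m| ^+ 2 = 2 * `|x - w n| ^+ 2 + 2 * `|x - w m| ^+ 2 -
      `|x - w n + (x - w m)| ^+ 2 by rewrite -par; ring.
  apply: (@le_trans _ _ (2 * (d + t) ^+ 2 + 2 * (d + t) ^+ 2 - (2 * d) ^+ 2)).
    by rewrite lerB // lerD // ler_pM2l.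
  have -> : 2 * (d + t) ^+ 2 + 2 * (d + t) ^+ 2 - (2 * d) ^+ 2 =
      8 * d * t + 4 * t * t by ring.
  by rewrite [leRHS]mulrDl lerD2l ler_piMr // mulr_ge0.
have cw : cauchy (w @ \oo).
  apply/cauchy_exP => e e0.
  have c0 : 0 < 8 * d + 4 by rewrite ltr_wpDl // mulr_ge0.
  have : 0 < e ^+ 2 / (8 * d + 4) by rewrite divr_gt0 // exprn_gt0.
  move=> /natSinv_small[N _ /(_ _ (leqnn N)) /=].
  rewrite ltr_pdivlMr // mulrC => Ne.
  exists (w N); exists N => // m /= Nm; rewrite -ball_normE /=.
  have := le_lt_trans (small _ _ Nm) Ne.
  by rewrite ltr_pXn2r // nnegrE // ltW.
have /cvg_ex[p wp] : cvg (w @ \oo) by apply/cauchy_cvgP.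
exists p.
  by apply: (closed_cvg A cA _ _ wp); apply: nearW => n; case: (wP n).
move=> y Ay; apply: le_trans (dmin _ Ay).
apply/ler_addgt0Pr => e e0; have e20 : 0 < e / 2 by rewrite divr_gt0.
near \oo => n.
rewrite -[x - p](subrK (x - w n)) (le_trans (ler_normD _ _)) //.
have -> : x - p - (x - w n) = w n - p by rewrite opprB addrC addrA subrK.
rewrite [e]splitr addrCA lerD //.
  rewrite distrC ltW //; near: n; by move/cvgrPdist_lt: wp; apply.
rewrite ltW //; have [_ /lt_trans->//] := wP n.
rewrite ltrD2l; near: n; exact: natSinv_small.
Unshelve. all: by end_near. Qed.

(** If [x - p] were not orthogonal to [y], then [p + t *: y] would be closer to
    [x] than [p], for the [t] that makes [x - p - t *: y] orthogonal to [y]. *)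
Lemma orthogonal_projection A x : linear_subspace A -> closed A ->
  exists2 p, A p & forall y, A y -> inner (x - p) y = 0.
Proof.
move=> lA cA; have [p Ap pmin] := nearest_point x lA cA.
exists p => // y Ay; have [->|y0] := eqVneq y 0; first by rewrite linear0r.
set v := x - p; set a := inner v y.
have ny0 : inner y y != 0 by apply: contra_neq y0; apply: inner_eq0.
pose t := a / inner y y.
have vt : inner (v - t *: y) (t *: y) = 0.
  by rewrite innerZr linearBl /= innerZl divfK // subrr mulr0.
have := pythagoras vt; rewrite subrK => vE.
have : `|v| <= `|v - t *: y|.
  rewrite -addrA -opprD; apply: pmin; apply: subspaceD => //.
  exact: subspaceZ.
rewrite -(@ler_pXn2r _ 2) ?nnegrE // vE -lerBrDl subrr => ty.
have : `|t *: y| ^+ 2 == 0 by rewrite eq_le ty exprn_ge0.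
rewrite expf_eq0 normr_eq0 /= scaler_eq0 (negPf y0) orbF mulf_eq0 invr_eq0.
by rewrite (negPf ny0) orbF => /eqP.
Qed.

End Projection.

(** * The mean ergodic theorem *)

Section MeanErgodic.
Context {R : realType} {H : hilbertType R}.
Implicit Types (x y z : H) (V : {linear H -> H}) (e : R[i]).

(** Polarization, with the vectors [x + y] and ['i *: x + y]. *)
Lemma isometry_inner V x y :
  (forall z, `|V z| = `|z|) -> inner (V x) (V y) = inner x y.
Proof.
move=> isoV.
have polar z u : inner z u + inner u z = inner (V z) (V u) + inner (V u) (V z).
  have := sqr_normD (V z) (V u); rewrite -linearD !isoV sqr_normD.
  by move/addrI.
have := polar x y; have := polar ('i *: x) y.
have -> : V ('i *: x) = 'i *: V x by rewrite linearZ.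
rewrite !innerZl !innerZr conjCi !mulNr -!mulrBr.
move/(mulfI (neq0Ci _)) => eB eD.
have two0 : 2 != 0 :> R[i] by rewrite pnatr_eq0.
apply: (mulfI two0); move: eB eD.
set a := inner x y; set b := inner y x; set a' := inner _ _; set b' := inner _ _.
move=> eB eD.
have -> : 2 * a' = (a' - b') + (a' + b') by ring.
by rewrite -eB -eD; ring.
Qed.

Lemma iter_isometry V n x : (forall z, `|V z| = `|z|) -> `|iter n V x| = `|x|.
Proof. by move=> isoV; elim: n => //= n IHn; rewrite isoV. Qed.

Lemma iter_linear V n (a : R[i]) x y :
  iter n V (a *: x + y) = a *: iter n V x + iter n V y.
Proof. by elim: n => //= n ->; rewrite linearP. Qed.

Definition ergodic_mean V n x : H := n.+1%:R^-1 *: \sum_(k < n.+1) iter k V x.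

Lemma ergodic_mean_linear V n (a : R[i]) x y :
  ergodic_mean V n (a *: x + y) =
  a *: ergodic_mean V n x + ergodic_mean V n y.
Proof.
rewrite /ergodic_mean; under eq_bigr do rewrite iter_linear.
by rewrite big_split /= -scaler_sumr scalerDr !scalerA mulrC.
Qed.

Lemma ergodic_meanB V n x y :
  ergodic_mean V n (x - y) = ergodic_mean V n x - ergodic_mean V n y.
Proof. by rewrite addrC -scaleN1r ergodic_mean_linear scaleN1r addrC. Qed.

Lemma ergodic_mean_fixed V n x : V x = x -> ergodic_mean V n x = x.
Proof.
move=> Vx; rewrite /ergodic_mean.
under eq_bigr => k _ do rewrite iter_fix //.
rewrite sumr_const card_ord -[x *+ _]scaler_nat scalerA mulVf.
  by rewrite scale1r.
by rewrite pnatr_eq0.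
Qed.

Lemma norm_ergodic_mean V n x :
  (forall z, `|V z| = `|z|) -> `|ergodic_mean V n x| <= `|x|.
Proof.
move=> isoV; rewrite normrZ ger0_norm ?invr_ge0 ?ler0n //.
rewrite ler_pdivrMl ?ltr0n // (le_trans (ler_norm_sum _ _ _)) //.
under eq_bigr do rewrite iter_isometry //.
by rewrite sumr_const card_ord mulr_natl.
Qed.

(** The sum telescopes to [y - iter n.+1 V y]. *)
Lemma norm_ergodic_mean_coboundary V n y : (forall z, `|V z| = `|z|) ->
  `|ergodic_mean V n (y - V y)| <= n.+1%:R^-1 * (2 * `|y|).
Proof.
move=> isoV; rewrite ergodic_meanB -scalerBr normrZ.
rewrite ger0_norm ?invr_ge0 ?ler0n // ler_pM2l ?invr_gt0 ?ltr0n //.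
have -> : \sum_(k < n.+1) iter k V y - \sum_(k < n.+1) iter k V (V y) =
    y - iter n.+1 V y.
  elim: n => [|n IHn]; first by rewrite !big_ord1.
  rewrite big_ord_recr [X in _ - X]big_ord_recr /= opprD addrACA IHn.
  by rewrite /= -iterSr /= addrA subrK.
by rewrite (le_trans (ler_normB _ _)) // iter_isometry // mulr2n mulrDl mul1r.
Qed.

(** The mean ergodic theorem.  The vectors [z] whose means tend to [0] form a
    closed subspace containing all [y - V y]; a vector [q] orthogonal to it
    satisfies [inner q (q - V q) = 0], and then [V q = q] as [V] is isometric. *)
Lemma mean_ergodic V x : (forall z, `|V z| = `|z|) ->
  exists2 q, V q = q & ergodic_mean V n x @[n --> \oo] --> q.
Proof.
move=> isoV.
pose Z := [set z | ergodic_mean V n z @[n --> \oo] --> (0 : H)].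
have lZ : linear_subspace Z.
  split=> [|a u v Zu Zv]; rewrite /Z /=.
    rewrite (_ : ergodic_mean V ^~ 0 = cst 0); first exact: cvg_cst.
    by apply/funext => n; rewrite ergodic_mean_fixed ?linear0.
  under eq_cvg do rewrite ergodic_mean_linear.
  have := cvgD (cvgZl_tmp (k := a) Zu) Zv; rewrite scaler0 addr0; apply.
have cZ : closed Z.
  move=> u cu; apply/cvgrPdist_lt => e e0; rewrite /=.
  have e20 : 0 < e / 2 by rewrite divr_gt0.
  have [z Zz uz] := closure_approx cu e20.
  have := Zz; move=> /cvgrPdist_lt/(_ _ e20); apply: filterS => n.
  rewrite !sub0r !normrN => zn.
  rewrite -[ergodic_mean V n u](subrK (ergodic_mean V n z)) -ergodic_meanB.
  rewrite (le_lt_trans (ler_normD _ _)) // [e]splitr ltrD //.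
  exact: le_lt_trans (norm_ergodic_mean _ _ isoV) uz.
have cob y : Z (y - V y).
  apply/cvgrPdist_lt => e e0.
  have y1 : 0 < 2 * `|y| + 1 by rewrite ltr_wpDl // mulr_ge0.
  have : 0 < e / (2 * `|y| + 1) by rewrite divr_gt0.
  move=> /natSinv_small; apply: filterS => n.
  rewrite ltr_pdivlMr // => lte; rewrite sub0r normrN.
  apply: le_lt_trans (norm_ergodic_mean_coboundary _ _ isoV) _.
  by apply: le_lt_trans lte; rewrite ler_pM2l ?invr_gt0 ?ltr0n // lerDl.
have [z Zz zP] := orthogonal_projection x lZ cZ.
have Vq : V (x - z) = x - z.
  have : inner (x - z) ((x - z) - V (x - z)) = 0 by apply: zP.
  move: (x - z) => q qVq.
  have Vqq : inner (V q) (q - V q) = 0.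
    have := inner_eq0C qVq; rewrite linearBl linearBr /= isometry_inner //.
    by move=> /subr0_eq ->; rewrite subrr.
  apply/eqP; rewrite eq_sym -subr_eq0; apply/eqP/inner_eq0.
  by rewrite linearBl /= qVq Vqq subrr.
exists (x - z) => //.
apply: (@cvg_sub0 _ _ _ _ _ _ (fun=> x - z)); last exact: cvg_cst.
rewrite (_ : _ - _ = ergodic_mean V ^~ z) //; apply/funext => n.
transitivity (ergodic_mean V n x - ergodic_mean V n (x - z)).
  by rewrite [in RHS](ergodic_mean_fixed n Vq).
by rewrite -ergodic_meanB opprB addrC subrK.
Qed.

End MeanErgodic.

(** * Isometries on finite-dimensional subspaces *)

Section Spectrum.
Context {R : realType} {H : hilbertType R}.
Implicit Types (A : set H) (V : {linear H -> H}).

Definition orthogonal_to A : set H := [set y | forall x, A x -> inner x y = 0].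

Lemma subspace_orthogonal_to A : linear_subspace (orthogonal_to A).
Proof.
split=> [x _|a y z yA zA x Ax]; first by rewrite linear0r.
by rewrite linearDr /= innerZr yA // zA // mulr0 addr0.
Qed.

Lemma eigenspace_closed V lambda :
  (forall x, `|V x| = `|x|) -> closed (eigenspace_of V lambda).
Proof.
move=> isoV x cx; apply/eqP; rewrite -subr_eq0 -normr_eq0.
have l1 : 0 < 1 + `|lambda| by rewrite ltr_pwDl.
rewrite eq_le normr_ge0 andbT; apply/ler_addgt0Pr => e e0; rewrite add0r.
have [y Ey xy] := closure_approx cx (divr_gt0 e0 l1).
have -> : V x - lambda *: x = V (x - y) - lambda *: (x - y).
  by rewrite linearB scalerBr Ey opprB addrA subrK.
rewrite (le_trans (ler_normB _ _)) // normrZ isoV.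
by rewrite -[X in X + _]mul1r -mulrDl mulrC -ler_pdivlMr // ltW.
Qed.

(** An isometry is diagonalizable on a finite-dimensional invariant subspace:
    the orthogonal complement of an eigenvector is again invariant. *)
Lemma isometry_eigenbasis V n A (s : 'I_n -> H) :
  (forall x, `|V x| = `|x|) -> linear_subspace A ->
  (forall x, A x -> A (V x)) -> quotient_basis A [set 0] s ->
  exists (t : 'I_n -> H) mu, eigenbasis A V t mu.
Proof.
move=> isoV; elim: n A s => [|n IHn] A s lA AV bs.
  by exists s, (fun=> 0); split=> // -[].
have [v [lambda [Av v0 Vv]]] := eigenvector_exists lA AV bs.
have vv0 : inner v v != 0 by apply: contra_neq v0; apply: inner_eq0.
pose X := A `&` orthogonal_to [set v].
have lX : linear_subspace X by apply: subspaceI => //; apply: subspace_orthogonal_to.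
have XA : X `<=` A by move=> x [].
have vX : line v `&` X `<=` [set 0].
  move=> _ [[b _ <-] [_ /(_ v erefl)]] /=; rewrite innerZr => /eqP.
  by rewrite mulf_eq0 conjC_eq0 (negPf vv0) orbF => /eqP ->; rewrite scale0r.
have dec w : A w -> exists2 x, X x & line v (w - x).
  move=> Aw; exists (w - (inner w v / inner v v) *: v).
    split; first by apply: subspaceB => //; apply: subspaceZ.
    move=> _ ->; apply: inner_eq0C.
    by rewrite linearBl /= innerZl divfK // subrr.
  by exists (inner w v / inner v v) => //; rewrite opprB addrC subrK.
have XV x : X x -> X (V x).
  move=> [Ax xv]; split; [exact: AV|move=> _ ->].
  have l0 : lambda != 0.
    apply: contra_neq v0 => l0; apply/eqP; rewrite -normr_eq0 -isoV Vv l0.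
    by rewrite scale0r normr0.
  apply/eqP; rewrite -(mulrI_eq0 _ (lregP l0)) -innerZl -Vv isometry_inner //.
  by rewrite xv.
have [t bt] := quotient_basis_line bs Av v0.
have [t' bt'] := complement_quotient_basis (subspace_line v) lX XA vX dec bt.
have [u [mu [bu Vu]]] := IHn _ _ lX XV bt'.
exists (fun i => oapp u v (unlift ord0 i)).
exists (fun i => oapp mu lambda (unlift ord0 i)); split=> [|i].
  exact: quotient_basis_cons bu.
by case: unlift.
Qed.

(** [S] is the list of eigenvalues of [V] on [A], with multiplicities. *)
Definition spectrum_on A V (S : seq R[i]) :=
  [/\ trace A V = \sum_(lambda <- S) lambda,
      forall lambda, finite_dim (A `&` eigenspace_of V lambda),
      forall lambda, Defs.dim (A `&` eigenspace_of V lambda) = count_mem lambda S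
    & forall lambda, lambda \in S -> Eig V lambda].

Lemma spectrum_exists V A : (forall x, `|V x| = `|x|) -> linear_subspace A ->
  (forall x, A x -> A (V x)) -> finite_dim A -> exists S, spectrum_on A V S.
Proof.
move=> isoV lA AV [n [s bs]].
have [t [mu bt]] := isometry_eigenbasis isoV lA AV bs.
exists [seq mu j | j <- enum 'I_n]; split.
- by rewrite (eigenbasis_trace bt) big_map big_enum.
- by move=> lambda; do 2 eexists; apply: eigenbasis_eigenspace lA bt.
- move=> lambda; rewrite (dimE (eigenbasis_eigenspace lambda lA bt)).
  by rewrite count_map -size_filter cardE enumT; congr size; apply: eq_filter.
- move=> _ /mapP[j _ ->]; case: bt => -[_ free _] Vt; exists (t j); last exact: Vt.
  apply/eqP => tj0; suff /eqP : (j == j)%:R = 0 :> R[i] by rewrite eqxx oner_eq0.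
  apply: (free (fun i => (i == j)%:R)).
  rewrite /= (bigD1 j) //= tj0 scaler0 add0r big1 // => i /negPf ->.
  by rewrite scale0r.
Qed.

End Spectrum.

(** * Restrictions of an equivariant operator to eigenspaces *)

Section EquivariantOperator.
Context {R : realType} {Gamma : groupType} {H1 H2 : hilbertType R}.
Context (rho1 : unitary_rep Gamma H1) (rho2 : unitary_rep Gamma H2).
Context (g : Gamma) (T : operator H1 H2).
Context (fredT : fredholm setT setT T) (equivT : equivariant rho1 rho2 g T).
Implicit Types (lambda : R[i]).

Local Notation E1 := (eigenspace_of (rho1 g)).
Local Notation E2 := (eigenspace_of (rho2 g)).
Local Notation ker := (op_ker T).
Local Notation ran := (op_range T).
Local Notation coker := (orthogonal_to (op_range T)).

Let iso1 x : `|rho1 g x| = `|x|. Proof. exact: rep_isometric. Qed.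
Let iso2 x : `|rho2 g x| = `|x|. Proof. exact: rep_isometric. Qed.

Let subspace_dom : linear_subspace (op_dom T).
Proof. by case: fredT => _ []. Qed.

Let opP (a : R[i]) x y : op_dom T x -> op_dom T y ->
  T (a *: x + y) = a *: T x + T y.
Proof. by case: fredT => _ [_ _ _ +] _ _ _; apply. Qed.

Let op0 : T 0 = 0.
Proof.
have := opP 1 (subspace0 subspace_dom) (subspace0 subspace_dom).
by rewrite !scale1r addr0 => /eqP; rewrite eq_sym -subr_eq0 addrK => /eqP.
Qed.

Let dom_rep x : op_dom T x -> op_dom T (rho1 g x).
Proof. by case: equivT => + _ _; apply. Qed.

Let op_rep x : op_dom T x -> T (rho1 g x) = rho2 g (T x).
Proof. by case: equivT => _ _; apply. Qed.

(* [rho1 g] maps the domain onto itself: this is what makes the orthogonal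
   complement of the range invariant, and not just the range. *)
Let dom_repV x : op_dom T x ->
  exists2 y, op_dom T y & x = rho1 g y.
Proof.
move=> Tx; exists (rho1 g^-1%g x); first by case: equivT => _ + _; apply.
by rewrite -repM mulgV rep1.
Qed.

Lemma subspace_ker : linear_subspace ker.
Proof.
split; first by split; [exact: subspace0 subspace_dom|exact: op0].
move=> a x y [Tx Tx0] [Ty Ty0]; split; first by case: subspace_dom => _; apply.
by rewrite opP // Tx0 Ty0 scaler0 addr0.
Qed.

Lemma subspace_range : linear_subspace ran.
Proof.
split; first by exists 0; [exact: subspace0 subspace_dom|exact: op0].
move=> a _ _ [x Tx <-] [y Ty <-]; exists (a *: x + y); last exact: opP.
by case: subspace_dom => _; apply.
Qed.

Lemma ker_rep x : ker x -> ker (rho1 g x).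
Proof.
by move=> [Tx Tx0]; split; [exact: dom_rep|rewrite op_rep // Tx0 linear0].
Qed.

Lemma range_rep y : ran y -> ran (rho2 g y).
Proof.
by move=> [x Tx <-]; exists (rho1 g x); [exact: dom_rep|exact: op_rep].
Qed.

Lemma coker_rep y : coker y -> coker (rho2 g y).
Proof.
move=> yT _ [x /dom_repV[x' Tx' ->] <-].
by rewrite op_rep // isometry_inner //; apply: yT; exists x'.
Qed.

Lemma coker_decomposition y : exists2 z, coker z & ran (y - z).
Proof.
have cT : closed ran by case: fredT.
have [p Tp yp] := orthogonal_projection y subspace_range cT.
exists (y - p); first by move=> u Tu; apply: inner_eq0C; apply: yp.
by rewrite subKr.
Qed.

Lemma range_cokerI : ran `&` coker `<=` [set 0].
Proof. by move=> y [Ty /(_ y Ty) /inner_eq0]. Qed.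

Lemma finite_dim_coker : finite_dim coker.
Proof.
have [n [s bs]] : finite_codim setT ran by case: fredT => _ _ _ _ [].
have [t bt] := complement_quotient_basis subspace_range
  (subspace_orthogonal_to _) (@subsetT _ _) range_cokerI
  (fun y _ => coker_decomposition y) bs.
by exists n, t.
Qed.

(** A vector [y] orthogonal to the range satisfies [adjoint_at T y 0].  The value
    chosen by [adjoint] is then [0], since [adjoint_at T y z] determines [z]: a
    vector orthogonal to the dense domain vanishes. *)
Lemma ker_adjoint : op_ker (adjoint T) = coker.
Proof.
have dense_orth z : (forall x, op_dom T x -> inner x z = 0) -> z = 0.
  move=> zT; have cz : closure (op_dom T) z by case: fredT => _ _ [_ +] _ _; apply.
  apply/eqP; rewrite -normr_eq0 eq_le normr_ge0 andbT.
  apply/ler_addgt0Pr => e e0; rewrite add0r.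
  have [x Tx /ltW zx] := closure_approx cz e0; apply: le_trans zx.
  rewrite -(@ler_pXn2r _ 2) ?nnegrE // pythagoras ?lerDl ?exprn_ge0 //.
  by rewrite linearNr /= (inner_eq0C (zT _ Tx)) oppr0.
apply/seteqP; split=> y.
  move=> [[z zy] /= y0] _ [x Tx <-].
  have := xgetPex 0 (ex_intro _ z zy : exists z, adjoint_at T y z).
  by rewrite y0 => /(_ x Tx) ->; rewrite linear0r.
move=> yT; have y0 : adjoint_at T y 0.
  by move=> x Tx; rewrite linear0r; apply: yT; exists x.
split; first by exists 0.
apply: xget_unique => // z yz; apply: dense_orth => x Tx.
by rewrite -yz //; apply: yT; exists x.
Qed.

Lemma op_sum n (x : nat -> H1) : (forall k, op_dom T (x k)) ->
  T (\sum_(k < n) x k) = \sum_(k < n) T (x k).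
Proof.
move=> Tx; elim: n => [|n IHn]; first by rewrite !big_ord0.
have TS : op_dom T (\sum_(k < n) x k) by apply: subspace_sum.
have := opP 1 (Tx n) TS; rewrite !scale1r IHn !big_ord_recr /= addrC => ->.
by rewrite addrC.
Qed.

(** The ergodic means of [lambda^-1 *: rho1 g] preserve the closed graph of [T],
    hence so does their limit [p], the orthogonal projection of [x] onto
    [E1 lambda].  The last two clauses are what is needed of it: [p] is as good an
    approximation as [x] of any vector of [E1 lambda], and [T p = T x] as soon as
    [T x] is an eigenvector. *)
Lemma eigen_projection lambda x : `|lambda| = 1 -> op_dom T x ->
  exists p, [/\ op_dom T p, E1 lambda p,
    forall y, E1 lambda y -> `|p - y| <= `|x - y|
    & E2 lambda (T x) -> T p = T x].
Proof.
move=> l1 Tx; have l0 : lambda != 0 by rewrite -normr_eq0 l1 oner_eq0.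
pose V1 : {linear H1 -> H1} := lambda^-1 \*: rho1 g.
pose V2 : {linear H2 -> H2} := lambda^-1 \*: rho2 g.
have isoV1 z : `|V1 z| = `|z| by rewrite /= normrZ normfV l1 invr1 mul1r.
have isoV2 z : `|V2 z| = `|z| by rewrite /= normrZ normfV l1 invr1 mul1r.
have fix1 z : V1 z = z <-> E1 lambda z by exact: fixed_eigenspace.
have fix2 z : V2 z = z <-> E2 lambda z by exact: fixed_eigenspace.
have iterT k : op_dom T (iter k V1 x) /\ T (iter k V1 x) = iter k V2 (T x).
  elim: k => [|k [Tk Ek]] //=; have Tk1 := dom_rep Tk; split.
    exact: subspaceZ.
  have := opP lambda^-1 Tk1 (subspace0 subspace_dom).
  by rewrite !addr0 op0 addr0 op_rep // Ek.
have meanT n : op_dom T (ergodic_mean V1 n x) /\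
    T (ergodic_mean V1 n x) = ergodic_mean V2 n (T x).
  have TS : op_dom T (\sum_(k < n.+1) iter k V1 x).
    by apply: subspace_sum => // k _; case: (iterT k).
  split; first exact: subspaceZ.
  rewrite /ergodic_mean; have := opP n.+1%:R^-1 TS (subspace0 subspace_dom).
  rewrite !addr0 op0 addr0 => ->; rewrite op_sum => [|k]; last by case: (iterT k).
  by congr (_ *: _); apply: eq_bigr => k _; case: (iterT k).
have [p Vp xp] := mean_ergodic x isoV1; have [q _ xq] := mean_ergodic (T x) isoV2.
have [Tp qE] : op_graph T (p, q).
  have cT : closed (op_graph T) by case: fredT => _ _ [].
  have lim : (ergodic_mean V1 n x, ergodic_mean V2 n (T x)) @[n --> \oo] --> (p, q).
    exact: cvg_pair.
  by apply: (closed_cvg _ cT _ _ lim); apply: nearW => n; have [] := meanT n.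
exists p; split=> //.
- exact/fix1.
- move=> y /fix1 Vy; apply/ler_addgt0Pr => e e0.
  move/cvgrPdist_le: xp => /(_ _ e0)[N _ /(_ _ (leqnn N)) /= Ne].
  rewrite -[p - y](subrK (p - ergodic_mean V1 N x)).
  rewrite (le_trans (ler_normD _ _)) // lerD //.
  rewrite opprB addrC addrA subrK -{1}[y](ergodic_mean_fixed N Vy) -ergodic_meanB.
  exact: norm_ergodic_mean.
- move=> /fix2 VTx; rewrite -qE; move: xq.
  rewrite (_ : ergodic_mean V2 ^~ (T x) = cst (T x)); last first.
    by apply/funext => n; rewrite ergodic_mean_fixed.
  move=> xq; apply: (cvg_unique (@norm_hausdorff _ _) xq); exact: cvg_cst.
Qed.

Lemma range_restrict lambda : `|lambda| = 1 ->
  op_range (Defs.restrict T (E1 lambda)) = ran `&` E2 lambda.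
Proof.
move=> l1; apply/seteqP; split=> [_ [x [Tx Ex] <-]|_ [[x Tx <-] ETx]].
  split; first by exists x.
  rewrite /eigenspace_of /= -op_rep // Ex.
  have := opP lambda Tx (subspace0 subspace_dom).
  by rewrite !addr0 op0 addr0.
have [p [Tp Ep _ /(_ ETx) <-]] := eigen_projection l1 Tx.
by exists p.
Qed.

Lemma ker_restrict lambda :
  op_ker (Defs.restrict T (E1 lambda)) = ker `&` E1 lambda.
Proof.
by apply/seteqP; split=> x [[]] => [Tx Ex T0|Tx T0 Ex].
Qed.

(** The component [z] of [y] in [coker] is again an eigenvector, as
    [rho2 g z - lambda *: z] lies both in [coker] and in the range. *)
Lemma coker_eigen_decomposition lambda y : E2 lambda y ->
  exists2 z, (coker `&` E2 lambda) z & (ran `&` E2 lambda) (y - z).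
Proof.
move=> Ey; have [z zT yz] := coker_decomposition y.
have Ez : E2 lambda z.
  apply/eqP; rewrite -subr_eq0; apply/eqP; apply: range_cokerI; split; last first.
    apply: subspaceB (subspace_orthogonal_to _) _ _; first exact: coker_rep.
    exact: subspaceZ (subspace_orthogonal_to _) _.
  have -> : rho2 g z - lambda *: z = lambda *: (y - z) - rho2 g (y - z).
    by rewrite (linearB (rho2 g)) Ey scalerBr opprB [RHS]addrC addrA subrK.
  apply: subspaceB subspace_range _ _; last exact: range_rep.
  exact: subspaceZ subspace_range _.
exists z => //; split=> //.
by apply: subspaceB => //; apply: subspace_eigenspace.
Qed.

Lemma coker_eigen_basis lambda n (s : 'I_n -> H2) : `|lambda| = 1 ->
  quotient_basis (coker `&` E2 lambda) [set 0] s ->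
  quotient_basis (E2 lambda) (op_range (Defs.restrict T (E1 lambda))) s.
Proof.
move=> l1 bs; rewrite range_restrict //.
have lE := subspace_eigenspace (rho2 g) lambda.
apply: quotient_basis_complement bs.
- exact: subspaceI subspace_range lE.
- exact: subspaceI (subspace_orthogonal_to _) lE.
- exact: subIsetr.
- by move=> y [[Ty _] [yT _]]; apply: range_cokerI.
- exact: coker_eigen_decomposition.
Qed.

Lemma spectrum_ker : exists S, spectrum_on ker (rho1 g) S.
Proof.
apply: spectrum_exists => //; [exact: subspace_ker|exact: ker_rep|].
by case: fredT => _ _ _ _ [].
Qed.

Lemma spectrum_coker : exists S, spectrum_on coker (rho2 g) S.
Proof.
apply: spectrum_exists => //; [|exact: coker_rep|exact: finite_dim_coker].
exact: subspace_orthogonal_to.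
Qed.

Lemma eigen_indexE lambda : `|lambda| = 1 ->
  eigen_index rho1 rho2 g T lambda =
  (Defs.dim (ker `&` E1 lambda))%:Z - (Defs.dim (coker `&` E2 lambda))%:Z.
Proof.
move=> l1; rewrite /eigen_index /fredholm_index ker_restrict.
have [S [_ /(_ lambda)[n [s bs]] _ _]] := spectrum_coker.
rewrite (dimE bs) (codimE _ (coker_eigen_basis l1 bs)) // range_restrict //.
exact: subspaceI subspace_range (subspace_eigenspace _ _).
Qed.

Lemma eigen_restriction_fredholm lambda : `|lambda| = 1 ->
  eigen_fredholm rho1 rho2 g T lambda.
Proof.
move=> l1; have lE1 := subspace_eigenspace (rho1 g) lambda.
have cE1 := eigenspace_closed (lambda := lambda) iso1.
have cE2 := eigenspace_closed (lambda := lambda) iso2.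
split.
- by split=> //; apply: subspace_eigenspace.
- split; [exact: subspaceI|exact: subIsetr| |].
    by rewrite range_restrict //; apply: subIsetr.
  by move=> a x y [Tx _] [Ty _]; apply: opP.
- split.
    rewrite (_ : op_graph _ = op_graph T `&` fst @^-1` E1 lambda).
      apply: closedI; first by case: fredT => _ _ [].
      by apply: preimage_closed => // x _; apply: cvg_fst.
    by apply/seteqP; split=> -[x y] /= [[]] => [Tx Ex yE|Tx yE Ex].
  move=> x Ex B /nbhs_ballP[e /= e0 xeB].
  have cx : closure (op_dom T) x by case: fredT => _ _ [_ +] _ _; apply.
  have [y Ty xy] := closure_approx cx e0.
  have [p [Tp Ep py _]] := eigen_projection l1 Ty.
  exists p; split=> //; apply: xeB; rewrite -ball_normE /= distrC.
  by rewrite (le_lt_trans (py _ Ex)) // distrC.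
- by rewrite range_restrict //; apply: closedI => //; case: fredT.
- split; first by rewrite ker_restrict; have [S []] := spectrum_ker.
  have [S [_ /(_ lambda)[n [s bs]] _ _]] := spectrum_coker.
  by exists n, s; apply: coker_eigen_basis.
Qed.

End EquivariantOperator.

(** * The index formula *)

Lemma eigenvalue_norm (R : realType) (H : hilbertType R) (V : {linear H -> H})
    lambda : (forall x, `|V x| = `|x|) -> Eig V lambda -> `|lambda| = 1.
Proof.
move=> isoV [x x0 Vx]; have nx0 : `|x| != 0 by rewrite normr_eq0.
by apply: (mulIf nx0); rewrite -normrZ -Vx isoV mul1r.
Qed.

Lemma sum_multiplicities (K : nzRingType) (S r : seq K) :
  uniq r -> {subset S <= r} ->
  \sum_(x <- r) x * (count_mem x S)%:R = \sum_(x <- S) x.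
Proof.
move=> ur; elim: S => [|a S IHS] Sr.
  by rewrite big_nil big1 // => x _; rewrite mulr0.
rewrite big_cons -IHS => [|x Sx]; last by rewrite Sr // inE Sx orbT.
have ar : a \in r by rewrite Sr // mem_head.
rewrite (bigD1_seq a) // [in RHS](bigD1_seq a) //= eqxx natrD mulrDr mulr1 addrA.
by congr (_ + _); apply: eq_bigr => x; rewrite eq_sym => /negPf ->.
Qed.

Theorem theorem3p6 (R : realType) (Gamma : groupType) (H1 H2 : hilbertType R)
    (rho1 : unitary_rep Gamma H1) (rho2 : unitary_rep Gamma H2) (g : Gamma)
    (T : operator H1 H2) :
  fredholm setT setT T ->
  equivariant rho1 rho2 g T ->
  let Lambda := Eig (rho1 g) `|` Eig (rho2 g) in
  [/\ forall lambda, Lambda lambda -> eigen_fredholm rho1 rho2 g T lambda,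
      finite_set [set lambda | Lambda lambda /\
                               eigen_index rho1 rho2 g T lambda != 0],
      equivariant_index rho1 rho2 g T =
        \sum_(lambda \in Lambda)
           lambda * (eigen_index rho1 rho2 g T lambda)%:~R &
      Eig (rho2 g) `<=` Eig (rho1 g) ->
      equivariant_index rho1 rho2 g T =
        \sum_(lambda \in Eig (rho1 g))
           lambda * (eigen_index rho1 rho2 g T lambda)%:~R].
Proof.
move=> fredT equivT Lambda.
have iso1 x : `|rho1 g x| = `|x| by apply: rep_isometric.
have iso2 x : `|rho2 g x| = `|x| by apply: rep_isometric.
have norm1 lambda : Lambda lambda -> `|lambda| = 1.
  by move=> [/(eigenvalue_norm iso1)|/(eigenvalue_norm iso2)].
have [S1 [tr1 _ dim1 S1E]] := spectrum_ker fredT equivT.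
have [S2 [tr2 _ dim2 S2E]] := spectrum_coker fredT equivT.
have indexE lambda : Lambda lambda -> eigen_index rho1 rho2 g T lambda =
    (count_mem lambda S1)%:Z - (count_mem lambda S2)%:Z.
  by move=> /norm1 l1; rewrite (eigen_indexE fredT equivT) // dim1 dim2.
(* A finite set of eigenvalues outside of which all the indices vanish. *)
pose r := undup (S1 ++ S2).
have rL : [set` r] `<=` Lambda.
  move=> lambda; rewrite /= mem_undup mem_cat => /orP[/S1E|/S2E]; first by left.
  by right.
have index0 lambda : Lambda lambda -> lambda \notin r ->
    eigen_index rho1 rho2 g T lambda = 0.
  move=> Ll; rewrite mem_undup mem_cat negb_or => /andP[l1 l2].
  by rewrite indexE // (count_memPn l1) (count_memPn l2).
have formula : equivariant_index rho1 rho2 g T =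
    \sum_(lambda \in Lambda) lambda * (eigen_index rho1 rho2 g T lambda)%:~R.
  rewrite /equivariant_index (ker_adjoint fredT) tr1 tr2.
  rewrite -(fsbig_widen [set` r]) //; last first.
    by move=> lambda [Ll /negP lr] /=; rewrite index0 // mulr0.
  rewrite -fsbig_seq ?undup_uniq //.
  symmetry; transitivity (\sum_(lambda <- r)
      (lambda * (count_mem lambda S1)%:R - lambda * (count_mem lambda S2)%:R)).
    by apply: eq_big_seq => lambda /rL/indexE ->; rewrite rmorphB /= mulrBr.
  by rewrite sumrB !sum_multiplicities ?undup_uniq // => x xS;
    rewrite mem_undup mem_cat xS ?orbT.
split=> //.
- by move=> lambda /norm1; apply: eigen_restriction_fredholm.
- apply: (sub_finite_set _ (finite_seq r)) => lambda [Ll /=].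
  by apply: contraR => /index0 ->.
- by move=> E21; rewrite formula /Lambda (setUidl E21).
Qed.
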